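(* Let $\varepsilon \in (0,1/3)$, let $k$ be a positive integer, let $G$ be a finite graph with minimum degree at least $k$, and let $v$ be an arbitrary vertex of $G$. If $p \in [0,1]$ satisfies $p \ge \frac{1+\varepsilon}{k}$, then \[ \Pr\big(\text{the connected component of } v \text{ in } G_p \text{ has at least } \varepsilon k/2 \text{ vertices}\big) > \varepsilon/6. \]
   Context: For a graph $G$ and $p \in [0,1]$, $G_p$ is the random spanning subgraph of $G$ (same vertex set) obtained by keeping each edge of $G$ independently with probability $p$. *)

(* Defs.v *)
From HB Require Import structures.
From mathcomp Require Import all_boot all_order all_algebra.
From mathcomp Require Import reals.

Set Implicit Arguments.
Unset Strict Implicit.
Unset Printing Implicit Defensive.

Import Order.TTheory GRing.Theory Num.Theory.
Local Open Scope ring_scope.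

(* A finite simple graph is a symmetric irreflexive relation [e] on a finite
   type of vertices; its edges are the unordered pairs [set x; y] with [e x y].
   A spanning subgraph is given by its set of edges F \subset edges e. *)
Definition degree (T : finType) (e : rel T) (x : T) : nat := #|[set y | e x y]|.

Definition edges (T : finType) (e : rel T) : {set {set T}} :=
  [set [set z.1; z.2] | z : T * T & e z.1 z.2].

Definition adj (T : finType) (F : {set {set T}}) : rel T :=
  [rel x y | (x != y) && ([set x; y] \in F)].

Definition component (T : finType) (F : {set {set T}}) (v : T) : {set T} :=
  [set u | connect (adj F) v u].

(* The law of the edge set of G_p: the product over the edges of G of
   Bernoulli(p) laws. *)
Definition perc_weight (R : realType) (T : finType) (e : rel T) (p : R)
    (F : {set {set T}}) : R :=
  \prod_(f in edges e) (if f \in F then p else 1 - p).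

Definition perc_prob (R : realType) (T : finType) (e : rel T) (p : R)
    (A : pred {set {set T}}) : R :=
  \sum_(F in powerset (edges e) | A F) perc_weight e p F.

Lemma mem_edges (T : finType) (e : rel T) (x y : T) :
  symmetric e -> ([set x; y] \in edges e) = e x y.
Proof.
move=> e_sym; apply/imsetP/idP => [[[a b]] /=|exy]; last first.
  by exists (x, y); rewrite ?inE.
rewrite inE /= => eab E.
have [/set2P xab /set2P yab] : x \in [set a; b] /\ y \in [set a; b].
  by split; rewrite -E ?set21 ?set22.
have [/set2P axy /set2P bxy] : a \in [set x; y] /\ b \in [set x; y].
  by split; rewrite E ?set21 ?set22.
case: xab => xE; case: yab => yE; subst x y; rewrite // 1?e_sym //.
  by case: bxy => bE; subst b.
by case: axy => aE; subst a.
Qed.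

Lemma adj_edges (T : finType) (e : rel T) :
  symmetric e -> irreflexive e -> adj (edges e) =2 e.
Proof.
move=> e_sym e_irr x y; rewrite /adj /= mem_edges //.
by case: eqVneq => // ->; rewrite e_irr.
Qed.

(* These inclusion probabilities determine the law: each edge is kept with
   probability p, independently of the others. *)
Lemma perc_prob_sub (R : realType) (T : finType) (e : rel T) (p : R)
    (S : {set {set T}}) :
  S \subset edges e -> perc_prob e p (fun F => S \subset F) = p ^+ #|S|.
Proof.
move=> /subsetP SE.
pose f i := if i \in edges e then p else 0.
pose g i := if i \in S then 0 else if i \in edges e then 1 - p else 1.
transitivity (\prod_i (f i + g i)); last first.
  rewrite -prodr_const (big_mkcond (mem S)); apply: eq_bigr => i _ /=.
  rewrite /f /g; case: (boolP (i \in S)) => [/SE ->|_]; first by rewrite addr0.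
  by case: ifP => _; rewrite ?add0r // addrC subrK.
rewrite bigA_distr /perc_prob big_mkcond [RHS]big_mkcond; apply: eq_bigr => F _.
rewrite inE /=; case: andP => [[/subsetP FE /subsetP SF]|nFS].
  rewrite /perc_weight (big_mkcond (mem (edges e))); apply: eq_bigr => i _ /=.
  rewrite /f /g; case: ifPn => [iE|iE].
    by case: ifPn => // iF; case: ifPn => // /SF; rewrite (negPf iF).
  case: ifPn => [/FE|_]; first by rewrite (negPf iE).
  by case: ifPn => // /SE; rewrite (negPf iE).
case: (boolP (F \subset edges e)) => [FE|/subsetPn[i iF iE]]; last first.
  by rewrite (bigD1 i) //= iF /f (negPf iE) mul0r.
have /subsetPn[i iS iF] : ~~ (S \subset F) by apply/negP => SF; case: nFS.
by rewrite (bigD1 i) //= (negPf iF) /g iS mul0r.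
Qed.

Lemma perc_prob_total (R : realType) (T : finType) (e : rel T) (p : R) :
  perc_prob e p xpredT = 1.
Proof.
by rewrite -(expr0 p) -(@cards0 {set T}) -(@perc_prob_sub _ _ e) ?sub0set //;
  apply: eq_bigl => F; rewrite sub0set.
Qed.

(* Main.v *)
(** Explore the component of [v] one edge at a time, and let [A] be the set of
    discovered vertices whose edges to undiscovered vertices have not been
    examined. As long as fewer than [eps * k / 2] vertices are discovered, each
    vertex has at least [k * (1 - eps / 2)] undiscovered neighbours, so examining
    its edges produces on average at least
    [(1 + eps) * (1 - eps / 2) >= 1 + eps / 3] new vertices. With [s = eps / 4]
    this makes [(1 - s) ^+ #|A|] a supermartingale; it equals [1] when the
    exploration dies out, which therefore has probability at most [1 - s]. *)
Require Import Defs.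
From mathcomp Require Import all_boot all_order all_algebra.
From mathcomp Require Import reals.
From mathcomp Require Import ring lra.

Import Order.TTheory GRing.Theory Num.Theory.
Local Open Scope ring_scope.

(** The edge set [W] is arbitrary so that it can shrink as edges are examined; [W = edges e] with an
    indicator [g] recovers [perc_prob]. *)
Definition bernoulli_mean {R : comNzRingType} {S : finType} (p : R) (W : {set S})
    (g : {set S} -> R) : R :=
  \sum_(F in powerset W) (\prod_(f in W) (if f \in F then p else 1 - p)) * g F.

(** Conditioning on whether [f] is open: adding [f] matches the subsets of [W :\ f] with the subsets
    of [W] that contain [f]. *)
Lemma bernoulli_mean_split {R : comNzRingType} {S : finType} (p : R)
    (W : {set S}) (g : {set S} -> R) {f : S} : f \in W ->
  bernoulli_mean p W g =
    p * bernoulli_mean p (W :\ f) (fun F => g (f |: F)) +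
    (1 - p) * bernoulli_mean p (W :\ f) g.
Proof.
move=> fW; rewrite /bernoulli_mean (bigID (fun F : {set S} => f \in F)) /=.
congr (_ + _).
  rewrite (reindex_onto (fun F => f |: F) (fun F => F :\ f)) /=; last first.
    by move=> F /andP[_ fF]; rewrite setD1K.
  rewrite mulr_sumr; apply: eq_big => [F|F].
    rewrite !powersetE setU11 andbT subUset sub1set fW /= subsetD1.
    have [fF|fF] := boolP (f \in F); last by rewrite setU1K // eqxx !andbT.
    by rewrite !andbF; apply/andP => -[_ /eqP E]; rewrite -E setD11 in fF.
  rewrite setU11 andbT => /andP[_ /eqP E].
  rewrite (bigD1 f) //= setU11 mulrA; congr (p * _ * _).
  apply: eq_big => [i|i /andP[_ ni]]; first by rewrite !inE andbC.
  by rewrite !inE (negPf ni).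
rewrite mulr_sumr; apply: eq_big => [F|F /andP[_ fF]].
  by rewrite !powersetE subsetD1.
rewrite (bigD1 f) //= (negPf fF) mulrA; congr (_ * _ * _).
by apply: eq_bigl => i; rewrite !inE andbC.
Qed.

Lemma bernoulli_mean1 (R : comNzRingType) (S : finType) (p : R) (W : {set S}) :
  bernoulli_mean p W (fun=> 1) = 1.
Proof.
have [n] := ubnP #|W|; elim: n W => // n IHn W ltWn.
have [->|[f fW]] := set_0Vmem W.
  by rewrite /bernoulli_mean powerset0 big_set1 big_set0 mulr1.
rewrite (bernoulli_mean_split _ _ _ fW) IHn; first by ring.
by rewrite (cardsD1 f W) fW in ltWn.
Qed.

Lemma bernoulli_mean_ge0 (R : numDomainType) (S : finType) (p : R)
    (W : {set S}) (g : {set S} -> R) :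
  0 <= p <= 1 -> (forall F, 0 <= g F) -> 0 <= bernoulli_mean p W g.
Proof.
move=> /andP[p0 p1] g0; apply: sumr_ge0 => F _; apply: mulr_ge0 => //.
by apply: prodr_ge0 => f _; case: ifP => // _; rewrite subr_ge0.
Qed.

Lemma component_subset (T : finType) (F F' : {set {set T}}) (v : T) :
  F \subset F' -> component F v \subset component F' v.
Proof.
move=> /subsetP FF'; apply/subsetP => u; rewrite !inE.
apply: connect_sub => x y /andP[nxy /FF' xyF]; apply: connect1.
by rewrite /adj /= nxy.
Qed.

(* State of the exploration: [W] is the set of unexamined edges, [F0] the set of
   open edges found so far, [D] the set of discovered vertices, and [N] the set
   of undiscovered neighbours of the current vertex [x] whose edge to [x] is
   still to be examined; [A] is as in the header and does not contain [x], except
   when [N] is empty. *)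
Lemma exploration_bound (R : realFieldType) (T : finType) (e : rel T) (v : T)
    (p s t : R) :
  0 <= p <= 1 -> 0 <= s <= 1 ->
  (forall (D : {set T}) a, #|D|%:R < t ->
     (1 - p * s) ^+ #|[set y | e a y] :\: D| <= 1 - s) ->
  forall (W F0 : {set {set T}}) (D A N : {set T}) (x : T),
  D \subset component F0 v -> A \subset D -> x \in D ->
  (forall y w, (y \in A) || (y \notin D) -> w \notin D -> e y w ->
     [set y; w] \in W) ->
  (forall n, n \in N -> [/\ n \notin D, x \notin A & [set x; n] \in W]) ->
  1 - (1 - s) ^+ #|A| * (1 - p * s) ^+ #|N| <=
    bernoulli_mean p W
      (fun F => (t <= #|component (F0 :|: F) v|%:R)%R%:R).
Proof.
move=> p01 s01 offspring W F0 D A N x.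
pose large F0 F : R := (t <= #|component (F0 :|: F) v|%:R)%R%:R.
rewrite -/(large F0).
have /andP[p0 p1] := p01; have /andP[s0 s1] := s01.
have ps0 : 0 <= 1 - p * s by rewrite subr_ge0 mulr_ile1.
(* Examining an edge shrinks [W] by one and adds at most one vertex to [A], hence the weight 2;
   passing to a new current vertex shrinks [A] alone. *)
have [m] := ubnP (#|W|.*2 + #|A|)%N.
elim: m W F0 D A N x => // m IHm W F0 D A N x ltm DC AD xD freshW NW.
have [n /= nN|N0] := pickP (mem N).
  have [nD xA fW] := NW n nN; set f := [set x; n] in fW.
  have nx : x != n by apply: contraNneq nD => <-.
  have cW : #|W| = (#|W :\ f|).+1 by rewrite (cardsD1 f W) fW.
  have nA : n \notin A by apply: contra nD; apply: (subsetP AD).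
  have cA : #|n |: A| = #|A|.+1 by rewrite cardsU1 nA.
  (* Since [x] is discovered and outside [A], the edge [f] is none of those that [freshW] keeps
     unexamined. *)
  have neq_f y w : y != x -> w != x -> [set y; w] != f.
    move=> yx wx; apply: contraNneq yx => E.
    have := set21 x n.
    by rewrite -/f -E !inE eq_sym [x == w]eq_sym (negPf wx) orbF.
  have freshWf y w : (y \in A) || (y \notin D) -> w \notin D -> e y w ->
      [set y; w] \in W :\ f.
    move=> yAD wD eyw; rewrite in_setD1 freshW // andbT neq_f //.
      by apply: contraTneq yAD => ->; rewrite negb_or xA negbK.
    by apply: contraNneq wD => ->.
  have NWf y : y \in N :\ n -> [/\ y \notin D, y != n & [set x; y] \in W :\ f].
    rewrite in_setD1 => /andP[yn /NW[yD _ yW]]; split=> //.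
    rewrite in_setD1 yW andbT; apply: contraNneq yn => E.
    have yx : y != x by apply: contraNneq yD => ->.
    by have := set22 x y; rewrite E !inE (negPf yx).
  rewrite (bernoulli_mean_split _ _ _ fW) (cardsD1 n N) nN.
  have closed : 1 - (1 - s) ^+ #|A| * (1 - p * s) ^+ #|N :\ n| <=
      bernoulli_mean p (W :\ f) (large F0).
    apply: (IHm (W :\ f) F0 D A (N :\ n) x _ DC AD xD freshWf).
      by move: ltm; rewrite cW doubleS !addSn !ltnS => /ltnW.
    by move=> y /NWf[].
  have opened : 1 - (1 - s) ^+ #|A|.+1 * (1 - p * s) ^+ #|N :\ n| <=
      bernoulli_mean p (W :\ f) (fun F => large F0 (f |: F)).
    have -> : bernoulli_mean p (W :\ f) (fun F => large F0 (f |: F)) =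
      bernoulli_mean p (W :\ f) (large (f |: F0)) :> R.
      by apply: eq_bigr => F _; rewrite /large setUA [F0 :|: _]setUC.
    rewrite -cA; apply: (IHm _ _ (n |: D) _ _ x).
    - by move: ltm; rewrite cW cA doubleS !addSn addnS ltnS.
    - have CC' := component_subset _ _ _ v (subsetUr [set f] F0).
      have DC' := subset_trans DC CC'.
      rewrite subUset DC' sub1set andbT inE.
      have := subsetP DC' x xD; rewrite inE => /connect_trans; apply.
      by apply: connect1; rewrite /adj /= nx setU11.
    - exact: setUS.
    - by rewrite inE xD orbT.
    (* The new active vertex [n] was undiscovered until now, so [freshW] already covered its
       edges. *)
    - move=> y w yAD; rewrite !inE negb_or => /andP[_ wD].
      rewrite -in_setD1; apply: freshWf => //; move: yAD; rewrite !inE negb_or.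
      by case: eqVneq => [->|_] //=; rewrite nD orbT.
    - by move=> y /NWf[yD yn yW]; rewrite !inE !negb_or yn yD xA nx -in_setD1.
  (* The two bounds average exactly to the claim, as [p * (1 - s) + (1 - p) = 1 - p * s]. *)
  have := ler_wpM2l p0 opened; have : 0 <= 1 - p by lra.
  move=> /ler_wpM2l /(_ _ _ closed) hc ho.
  apply: le_trans (lerD ho hc); rewrite add1n !exprS le_eqVlt; apply/orP; left.
  by apply/eqP; ring.
have {N0 NW} -> : #|N| = 0%N by apply: eq_card0.
rewrite expr0 mulr1.
(* With no edge left at [x], either [D] is already large, or [A] is empty and the bound is 0, or
   some [a] in [A] becomes the current vertex. *)
have [Dt|tD] := ltP (#|D|%:R : R) t; last first.
  have -> : bernoulli_mean p W (large F0) = 1 :> R.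
    apply: etrans (bernoulli_mean1 R _ p W); apply: eq_bigr => F _.
    rewrite /large; suff -> : t <= #|component (F0 :|: F) v|%:R by [].
    apply: le_trans tD _; rewrite ler_nat subset_leq_card //.
    exact: subset_trans DC (component_subset _ _ _ v (subsetUl _ _)).
  by rewrite gerBl exprn_ge0 // subr_ge0.
have [->|[a aA]] := set_0Vmem A.
  by rewrite cards0 subrr bernoulli_mean_ge0 // => F; exact: ler0n.
have aD := subsetP AD a aA.
(* [offspring] pays for the factor [1 - s] lost when [a] leaves [A]. *)
apply: (@le_trans _ _ (1 - (1 - s) ^+ #|A :\ a| *
    (1 - p * s) ^+ #|[set y | e a y] :\: D|)).
  rewrite (cardsD1 a A) aA exprSr lerB // ler_wpM2l ?offspring //.
  by rewrite exprn_ge0 // subr_ge0.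
apply: (IHm _ _ D _ _ a) => //.
- by move: ltm; rewrite (cardsD1 a A) aA addnCA add1n ltnS.
- exact: subset_trans (subsetDl _ _) AD.
- move=> y w yAD; apply: freshW; move: yAD; rewrite !inE.
  by case/orP => [/andP[_ ->]|->] //; rewrite orbT.
- move=> n; rewrite !inE eqxx => /andP[nD ean]; split=> //.
  by apply: freshW; rewrite // aA.
Qed.

(* Bernoulli's inequality [(1 + q) ^+ n >= 1 + n * q] combined with
   [(1 - q) * (1 + q) <= 1]. *)
Lemma expr_subr1_bernoulli (R : realFieldType) (q : R) (n : nat) :
  0 <= q <= 1 -> (1 - q) ^+ n * (1 + n%:R * q) <= 1.
Proof.
move=> /andP[q0 q1]; elim: n => [|n IHn]; first by rewrite mul0r addr0 mulr1.
apply: le_trans IHn; rewrite exprSr -mulrA ler_wpM2l ?exprn_ge0 ?subr_ge0 //.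
rewrite -natr1; have : 0 <= n%:R * (q * q) :> R by rewrite !mulr_ge0.
have : 0 <= q * q by rewrite mulr_ge0.
by lra.
Qed.

Lemma offspring_bound (R : realFieldType) (eps p : R) (k n : nat) :
  0 < eps < 1 / 3 -> (0 < k)%N -> 0 <= p <= 1 -> (1 + eps) / k%:R <= p ->
  k%:R * (1 - eps / 2) <= n%:R ->
  (1 - p * (eps / 4)) ^+ n <= 1 - eps / 4.
Proof.
move=> /andP[eps0 eps1] k0 /andP[p0 p1] p_ge n_ge.
have kR : 0 < k%:R :> R by rewrite ltr0n.
have kp : 1 + eps <= p * k%:R by rewrite -ler_pdivrMr.
(* [(1 + eps) * (1 - eps / 2) - (1 + eps / 3) = eps * (1 - 3 * eps) / 6], which is where
   [eps < 1 / 3] enters. *)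
have np : 1 + eps / 3 <= n%:R * p.
  have h1 : p * (k%:R * (1 - eps / 2)) <= p * n%:R by rewrite ler_wpM2l.
  have h2 : (1 + eps) * (1 - eps / 2) <= p * k%:R * (1 - eps / 2).
    by rewrite ler_wpM2r //; lra.
  by nra.
set s := eps / 4.
have ps01 : 0 <= p * s <= 1.
  by rewrite mulr_ge0 ?mulr_ile1 //; rewrite /s; lra.
have := expr_subr1_bernoulli _ _ n ps01.
have : 1 + (1 + eps / 3) * s <= 1 + n%:R * (p * s).
  by rewrite lerD2l mulrA ler_wpM2r // /s; lra.
set y := (1 - p * s) ^+ n => h1 h2.
have y0 : 0 <= y by rewrite exprn_ge0 // subr_ge0; case/andP: ps01.
have h3 : y * (1 + (1 + eps / 3) * s) <= 1.
  by apply: le_trans h2; rewrite ler_wpM2l.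
have c0 : 0 < 1 + (1 + eps / 3) * s by rewrite /s; nra.
(* As [eps = 4 * s], the product [(1 - s) * (1 + (1 + eps / 3) * s)] equals
   [1 + s ^+ 2 * (1 - eps) / 3]. *)
rewrite -(ler_pM2r c0); apply: le_trans h3 _; rewrite /s; nra.
Qed.

Theorem theorem5p2 (R : realType) (eps : R) (k : nat) (T : finType) (e : rel T)
    (v : T) (p : R)
    (eps_bounds : 0 < eps < 1 / 3)
    (k_gt0 : (0 < k)%N)
    (e_sym : symmetric e) (e_irr : irreflexive e)
    (min_deg : forall x : T, (k <= degree e x)%N)
    (p_bounds : 0 <= p <= 1)
    (p_ge : (1 + eps) / k%:R <= p) :
  eps / 6 < perc_prob e p (fun F => eps * k%:R / 2 <= #|component F v|%:R).
Proof.
have /andP[eps0 eps1] := eps_bounds.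
have -> : perc_prob e p (fun F => eps * k%:R / 2 <= #|component F v|%:R) =
    bernoulli_mean p (edges e)
      (fun F => (eps * k%:R / 2 <= #|component (set0 :|: F) v|%:R)%R%:R).
  rewrite /perc_prob big_mkcondr; apply: eq_bigr => F _; rewrite set0U.
  by case: ifP => _; rewrite ?mulr1 ?mulr0.
(* The exploration starts with [v] alone discovered and active, which gives the bound [eps / 4]. *)
apply: (@lt_le_trans _ _ (1 - (1 - eps / 4) ^+ #|[set v]| *
    (1 - p * (eps / 4)) ^+ #|set0 : {set T}|)).
  by rewrite cards1 cards0 expr1 expr0; lra.
apply: (exploration_bound _ _ e v _ _ _ _ _ _ _ _ [set v] _ _ v) => //.
- by apply/andP; split; lra.
- move=> D a Dt; apply: (offspring_bound _ _ _ k) => //.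
  (* At most [#|D|], so fewer than [eps * k / 2], of the neighbours of [a] are discovered. *)
  have : (k <= #|[set y | e a y] :\: D| + #|D|)%N.
    apply: leq_trans (min_deg a) _; rewrite /degree -(cardsID D [set y | e a y]).
    by rewrite addnC leq_add2l subset_leq_card // subsetIr.
  by rewrite -(ler_nat R) natrD; lra.
- by rewrite sub1set inE connect0.
- by rewrite inE.
- by move=> y w _ _; rewrite mem_edges.
- by move=> n; rewrite in_set0.
Qed.
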